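(* Let $G$ be a bipartite graph on $n$ vertices. For every real $p$ with $0<p<2$, the following integral formula holds: $$\mathcal{E}_{p}(G) = \frac{2\sin \left(\frac{p \pi}{2}\right)}{\pi} \int_{0}^{\infty} z^{p-1} \left(n - iz\, \frac{\phi'(G,iz)}{\phi(G,iz)} \right) dz .$$
   Context: Graphs are finite, simple and undirected. For a graph $G$ on $n$ vertices, $A_G$ is its adjacency matrix, $\lambda_1,\dots,\lambda_n$ are the eigenvalues of $A_G$ (real, listed with multiplicity), and $\phi(G,x)=\det(xI-A_G)=\prod_{j=1}^n(x-\lambda_j)$ is its characteristic polynomial, regarded as a polynomial in a complex variable $x$; $\phi'(G,x)$ denotes its derivative with respect to $x$, and $\phi'(G,iz)$ is this derivative evaluated at $x=iz$. Here $i$ is the imaginary unit. The $p$-Schatten energy of $G$ is $\mathcal{E}_p(G)=\sum_{j=1}^n|\lambda_j|^p$ (for $p>0$, with $0^p=0$), i.e. the $p$-th power of the Schatten $p$-norm of $A_G$. *)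

(* Defs.v *)
From HB Require Import structures.
From mathcomp Require Import all_boot all_order all_algebra.
From mathcomp Require Import all_classical all_reals all_analysis.
From mathcomp Require Import complex.

Set Implicit Arguments.
Unset Strict Implicit.
Unset Printing Implicit Defensive.

Import Order.TTheory GRing.Theory Num.Theory.
Import numFieldNormedType.Exports.

Local Open Scope classical_set_scope.
Local Open Scope complex_scope.
Local Open Scope ring_scope.

Record sgraph (V : finType) := SGraph {
  edge :> rel V;
  edge_sym : symmetric edge;
  edge_irr : irreflexive edge
}.

Definition bipartite (V : finType) (G : sgraph V) :=
  exists A : {set V}, forall x y : V, G x y -> (x \in A) != (y \in A).

Definition adjacency (R : nzRingType) (V : finType) (G : sgraph V) :
    'M[R]_#|V| :=
  \matrix_(i, j) (G (enum_val i) (enum_val j))%:R.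

(* The characteristic polynomial of [G], over the complex numbers. *)
Definition phi (R : realType) (V : finType) (G : sgraph V) : {poly R[i]} :=
  char_poly (adjacency R[i] G).

(* The eigenvalues of a complex matrix, with algebraic multiplicity: the roots
   of its characteristic polynomial (see [char_poly_eigenvalues]). *)
Definition eigenvalues (R : realType) (n : nat) (A : 'M[R[i]]_n) : seq R[i] :=
  sval (closed_field_poly_normal (char_poly A)).

Lemma char_poly_eigenvalues (R : realType) (n : nat) (A : 'M[R[i]]_n) :
  char_poly A = \prod_(l <- eigenvalues A) ('X - l%:P).
Proof.
rewrite /eigenvalues; case: closed_field_poly_normal => s /= {1}->.
by rewrite (monicP (char_poly_monic A)) scale1r.
Qed.

Lemma size_eigenvalues (R : realType) (n : nat) (A : 'M[R[i]]_n) :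
  size (eigenvalues A) = n.
Proof.
apply/eqP; rewrite -eqSS -(size_prod_XsubC _ id) -(size_char_poly A).
by rewrite -char_poly_eigenvalues.
Qed.

(* [normc] is the real-valued complex modulus; for [p != 0], [0 `^ p = 0]. *)
Definition schatten_energy (R : realType) (V : finType) (p : R)
    (G : sgraph V) : R :=
  \sum_(l <- eigenvalues (adjacency R[i] G)) (Normc.normc l) `^ p.

Section ComplexIntegral.
Context d (T : measurableType d) (R : realType) (mu : {measure set T -> \bar R}).

Definition cintegrable (D : set T) (f : T -> R[i]) : Prop :=
  mu.-integrable D (fun x => (complex.Re (f x))%:E) /\
  mu.-integrable D (fun x => (complex.Im (f x))%:E).

(* Meaningful only under [cintegrable D f]. *)
Definition cintegral (D : set T) (f : T -> R[i]) : R[i] :=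
  (\int[mu]_(x in D) complex.Re (f x)) +i* (\int[mu]_(x in D) complex.Im (f x)).

End ComplexIntegral.

(* For [z > 0] the denominator is nonzero: the roots of [phi R G] are real. *)
Definition energy_integrand (R : realType) (V : finType) (p : R)
    (G : sgraph V) (z : R) : R[i] :=
  let iz := 'i%C * z%:C in
  (z `^ (p - 1))%:C *
  (#|V|%:R - iz * ((phi R G)^`().[iz] / (phi R G).[iz])).

(* Main.v *)
Require Import Defs.
From HB Require Import structures.
From mathcomp Require Import all_boot all_order all_algebra.
From mathcomp Require Import all_classical all_reals all_analysis.
From mathcomp Require Import complex measurable_realfun ring lra.

(** The logarithmic derivative of the characteristic polynomial is
    [\sum_l 1 / (x - l)] over the eigenvalues [l]. These are real, because the
    adjacency matrix is real and symmetric, so at [x = iz] each of them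
    contributes [1 - iz / (iz - l) = (l^2 + i z l) / (l^2 + z^2)] to the bracket
    in the integrand. The spectrum of a bipartite graph is symmetric about [0],
    so the imaginary parts cancel, and the integrand is the real function
    [z^(p - 1) * \sum_l l^2 / (l^2 + z^2)] ([energy_integrandE]).

    It remains to integrate one term. For [l != 0], the substitution
    [z = |l| e^x] gives [|l|^p * C (p - 1)], where [C q] is the integral of
    [cosh (q x) / cosh x] over [x >= 0] ([integral_resolvent_term]), and the
    theorem becomes the classical evaluation [C q = (pi / 2) * sec (pi q / 2)]
    for [-1 < q < 1] ([cosh_integralE]), which is Euler's reflection formula in
    disguise. It is proved here by Herglotz's trick. Both sides [F] are even and
    satisfy
      [3 F(q) + F(q / 3) = F((q - 2) / 3) + F((q + 2) / 3)]
    ([cosh_integral_triple], [sec_value_triple]): on the left this is a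
    substitution [x = 3 y], on the right a triple-angle formula. Both sides also
    equal [1 / (1 - |q|)] up to [O(1 - |q|)] ([cosh_integral_bounds],
    [sec_value_bounds]). Hence their difference is bounded, tends to [0] at both
    ends of the interval, and its absolute value is at most the average of its
    values at three points, of which the last lies closer to the end [1]; such a
    function vanishes ([maximum_principle]). *)

Import Order.TTheory GRing.Theory Num.Theory.
Import numFieldNormedType.Exports.

Local Open Scope classical_set_scope.
Local Open Scope complex_scope.
Local Open Scope ring_scope.

(** * The spectrum and the integrand *)

(** An invertible matrix anticommuting with a matrix conjugates it to its
    opposite. *)
Lemma char_poly_anticommute (F : fieldType) (n : nat) (P A : 'M[F]_n) :
  P \in unitmx -> P *m A = - (A *m P) -> char_poly (- A) = char_poly A.
Proof.
move=> Pu PA.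
pose Q := map_mx polyC P.
have dQ : \det Q != 0.
  by rewrite det_map_mx/= polyC_eq0 -unitfE -unitmxE.
apply: (mulIf dQ); rewrite [RHS]mulrC /char_poly -!det_mulmx /char_poly_mx.
rewrite mulmxBl mulmxBr scalar_mxC -!map_mxM /= PA.
by rewrite -mulNmx.
Qed.

Lemma char_polyN (F : comNzRingType) (n : nat) (A : 'M[F]_n) :
  char_poly (- A) = (-1) ^+ n * (char_poly A \Po (- 'X)).
Proof.
rewrite /char_poly.
rewrite -(det_map_mx (comp_poly (- 'X))) -detZ; congr (\det _).
apply/matrixP => i j; rewrite !mxE/= polyCN opprK comp_polyB comp_polyC.
by case: (i == j); rewrite ?mulr1n ?mulr0n ?comp_polyX ?comp_poly0; ring.
Qed.

(** The bipartition gives a diagonal matrix of signs that anticommutes with the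
    adjacency matrix, since every edge joins a [+1] to a [-1]. *)
Lemma eigenvalues_bipartite (R : realType) (V : finType) (G : sgraph V) :
  bipartite G ->
  perm_eq (eigenvalues (adjacency R[i] G))
    [seq - l | l <- eigenvalues (adjacency R[i] G)].
Proof.
move=> [S hS]; set A := adjacency _ G; set s := eigenvalues A.
have cN : char_poly (- A) = char_poly A.
  pose d : 'rV[R[i]]_#|V| := \row_j (if enum_val j \in S then 1 else -1).
  apply: (@char_poly_anticommute _ _ (diag_mx d)).
    rewrite unitmxE det_diag unitfE; apply/prodf_neq0 => j _.
    by rewrite mxE; case: ifP; rewrite ?oppr_eq0 oner_eq0.
  apply/matrixP => i j; rewrite mul_diag_mx mul_mx_diag !mxE.
  have [/hS|_] := boolP (G _ _); last by rewrite mulr0 mul0r oppr0.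
  by case: (enum_val i \in S); case: (enum_val j \in S) => //= _; ring.
apply/prod_XsubC_eq; rewrite -(char_poly_eigenvalues A) -cN char_polyN.
rewrite char_poly_eigenvalues -[X in _ ^+ X](size_eigenvalues A) -/s.
elim: s => [|l s IH] /=; first by rewrite !big_nil comp_polyC mul1r.
rewrite !big_cons comp_polyM -IH comp_polyB comp_polyX comp_polyC polyCN exprS.
by ring.
Qed.

(** For a left eigenvector [v] of [A] with conjugate [w], the number [v A w^T]
    equals [v w^T] times [l] and also times the conjugate of [l], and [v w^T] is
    positive. *)
Lemma eigenvalue_real_symmetric (R : realType) (n : nat) (A : 'M[R[i]]_n)
    (l : R[i]) : A^T = A ->
  map_mx (@conjc R) A = A -> eigenvalue A l -> l = (complex.Re l)%:C.
Proof.
move=> sA rA /eigenvalueP[v vA v0].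
pose w := map_mx (@conjc R) v.
have wA : w *m A = l^*%C *: w by rewrite -[in LHS]rA -map_mxM vA map_mxZ.
have /matrixP/(_ 0 0) : l *: (v *m w^T) = l^*%C *: (v *m w^T).
  by rewrite scalemxAl -vA -mulmxA -sA -trmx_mul wA linearZ/= -scalemxAr.
have N0 : (v *m w^T) 0 0 != 0.
  rewrite mxE; under eq_bigr do rewrite !mxE -sqr_normc.
  apply: contraNneq v0 => /eqP; rewrite psumr_eq0; last first.
    by move=> *; rewrite exprn_ge0.
  move=> /allP v0; apply/eqP/rowP => j; rewrite mxE; apply/eqP.
  by have := v0 j (mem_index_enum _); rewrite /= sqrf_eq0 normr_eq0.
rewrite [LHS]mxE [RHS]mxE => /(mulIf N0).
case: l {vA wA} => a b [] /= ab.
by congr (_ +i* _); lra.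
Qed.

Lemma eigenvalues_adjacency_real (R : realType) (V : finType)
    (G : sgraph V) (l : R[i]) :
  l \in eigenvalues (adjacency R[i] G) -> l = (complex.Re l)%:C.
Proof.
move=> ls; apply: (@eigenvalue_real_symmetric _ _ (adjacency R[i] G)).
- by apply/matrixP => i j; rewrite !mxE edge_sym.
- by apply/matrixP => i j; rewrite !mxE conjc_nat.
- by rewrite eigenvalue_root_char char_poly_eigenvalues root_prod_XsubC.
Qed.

Lemma complex_resolvent {R : realType} (l z : R) : z != 0 ->
  1 - 'i%C * z%:C / ('i%C * z%:C - l%:C) =
  (l ^+ 2 / (l ^+ 2 + z ^+ 2)) +i* (z * (l / (l ^+ 2 + z ^+ 2))).
Proof.
move=> z0.
have h : l ^+ 2 + z ^+ 2 != 0.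
  by rewrite gt_eqF// ltr_wpDl// ?sqr_ge0// exprn_even_gt0.
have E : 'i%C * z%:C - l%:C = (- l) +i* z by simpc.
have h0 : 'i%C * z%:C - l%:C != 0 by rewrite E eq_complex/= negb_and z0 orbT.
apply: (mulIf h0); rewrite mulrBl mulfVK// mul1r E.
apply/eqP; rewrite eq_complex/=; apply/andP; split; apply/eqP; field => //.
Qed.

Lemma log_deriv_prod_XsubC (F : fieldType) (s : seq F) (x : F) : x \notin s ->
  (\prod_(l <- s) ('X - l%:P))^`().[x] / (\prod_(l <- s) ('X - l%:P)).[x] =
  \sum_(l <- s) (x - l)^-1.
Proof.
elim: s => [_|l s IH]; first by rewrite !big_nil derivC horner0 mul0r.
rewrite inE negb_or => /andP[xl xs]; rewrite !big_cons -IH//.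
rewrite derivM derivXsubC mul1r hornerD !hornerM hornerXsubC.
have xl0 : x - l != 0 by rewrite subr_eq0.
have p0 : (\prod_(j <- s) ('X - j%:P)).[x] != 0.
  by rewrite -[_ == 0]/(root _ _) root_prod_XsubC.
field.
by rewrite p0.
Qed.

(** Summing [complex_resolvent] over the spectrum, the imaginary part is an odd
    function of the eigenvalue, so it vanishes on a symmetric spectrum. *)
Lemma energy_integrandE (R : realType) (V : finType) (p : R) (G : sgraph V)
    (z : R) : bipartite G -> 0 < z ->
  energy_integrand p G z =
  (\sum_(l <- eigenvalues (adjacency R[i] G))
     z `^ (p - 1) * (complex.Re l ^+ 2 / (complex.Re l ^+ 2 + z ^+ 2)))%:C.
Proof.
move=> hG z0; rewrite /energy_integrand /phi char_poly_eigenvalues.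
have sym := @eigenvalues_bipartite R V G hG.
have real_s := @eigenvalues_adjacency_real R V G.
set s := eigenvalues _ in sym real_s *.
rewrite log_deriv_prod_XsubC; last first.
  (* A real number cannot equal [iz] with [z > 0]. *)
  apply/negP => /real_s /eqP; rewrite eq_complex/= => /andP[_].
  by simpc; rewrite gt_eqF.
rewrite -[in #|V|%:R](size_eigenvalues (adjacency R[i] G)) -/s.
have -> : (size s)%:R - 'i%C * z%:C * \sum_(l <- s) ('i%C * z%:C - l)^-1 =
   (\sum_(l <- s) (complex.Re l ^+ 2 / (complex.Re l ^+ 2 + z ^+ 2))) +i*
   (z * \sum_(l <- s) (complex.Re l / (complex.Re l ^+ 2 + z ^+ 2))).
  elim: (s) real_s => [|l t IH] real_s.
    by rewrite !big_nil !mulr0 subr0.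
  have real_t k : k \in t -> k = (complex.Re k)%:C.
    by move=> kt; apply: real_s; rewrite inE kt orbT.
  have l_real := real_s l (mem_head _ _).
  have := complex_resolvent (complex.Re l) z; rewrite -l_real.
  rewrite gt_eqF// => /(_ isT) lE.
  rewrite !big_cons/=.
  rewrite [LHS](_ : _ = (1 - 'i%C * z%:C / ('i%C * z%:C - l)) +
    ((size t)%:R - 'i%C * z%:C * \sum_(k <- t) ('i%C * z%:C - k)^-1)).
    by rewrite lE IH//; simpc; rewrite -mulrDr.
  by rewrite -natr1; ring.
have -> : \sum_(l <- s) (complex.Re l / (complex.Re l ^+ 2 + z ^+ 2)) = 0.
  set t := LHS.
  suff : t = - t by lra.
  rewrite /t {1}(perm_big _ sym)/= big_map -sumrN; apply: eq_bigr => l _.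
  by rewrite raddfN/= sqrrN mulNr.
by rewrite mulr0 complexr0 -rmorphM/= mulr_sumr.
Qed.

(** * The integral of a quotient of hyperbolic cosines *)

(** This is [cosh (q x) / cosh x]. *)
Definition cosh_ratio {R : realType} (q x : R) : R :=
  (expR (q * x) + expR (- (q * x))) / (expR x + expR (- x)).

Definition cosh_integral {R : realType} (q : R) : \bar R :=
  (\int[@lebesgue_measure R]_(x in `[0%R, +oo[) (cosh_ratio q x)%:E)%E.

Lemma cosh_ratio_ge0 {R : realType} (q x : R) : 0 <= cosh_ratio q x.
Proof. by rewrite divr_ge0// addr_ge0// expR_ge0. Qed.

Lemma continuous_expRM {R : realType} (c : R) :
  continuous (fun x : R => expR (c * x)).
Proof.
move=> x; apply: (@continuous_comp _ _ _ ( *%R c) expR).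
  exact: mulrl_continuous.
exact: continuous_expR.
Qed.

Lemma continuous_expRNM {R : realType} (c : R) :
  continuous (fun x : R => expR (- (c * x))).
Proof.
move=> x; apply: (@continuous_comp _ _ _ (fun x => - (c * x)) expR).
  by apply: cvgN; exact: mulrl_continuous.
exact: continuous_expR.
Qed.

Lemma continuous_inv_2cosh {R : realType} :
  continuous (fun x : R => (expR x + expR (- x))^-1).
Proof.
move=> x; apply: cvgV; first by rewrite gt_eqF// addr_gt0// expR_gt0.
apply: cvgD; first exact: continuous_expR.
by apply: (@continuous_comp _ _ _ -%R expR);
  [exact: oppr_continuous|exact: continuous_expR].
Qed.

Lemma continuous_cosh_ratio {R : realType} (q : R) :
  continuous (cosh_ratio q).
Proof.
move=> x; apply: cvgM; last exact: continuous_inv_2cosh.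
by apply: cvgD; [exact: continuous_expRM|exact: continuous_expRNM].
Qed.

Lemma measurable_cosh_ratio {R : realType} (q : R) (D : set R) :
  measurable_fun D (cosh_ratio q).
Proof.
apply: measurable_funTS; apply: continuous_measurable_fun.
exact: continuous_cosh_ratio.
Qed.

Lemma cosh_integralN {R : realType} (q : R) :
  cosh_integral (- q) = cosh_integral q.
Proof.
by apply: eq_integral => x _; rewrite /cosh_ratio mulNr opprK addrC.
Qed.

Lemma integral_expRN {R : realType} (a : R) : 0 < a ->
  (\int[@lebesgue_measure R]_(x in `[0%R, +oo[) (expR (- (a * x)))%:E =
   (a^-1)%:E)%E.
Proof.
move=> a0.
have an0 : a != 0 by rewrite gt_eqF.
have dF (x : R) :
    is_derive x 1 (fun x : R => - (a^-1 * expR (- (a * x)))) (expR (- (a * x))).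
  apply: is_derive_eq.
  by rewrite /GRing.scale/= !(addr0, add0r, mulr0, mul0r, mulr1); field.
rewrite (@ge0_continuous_FTC2y _ _
  (fun x : R => - (a^-1 * expR (- (a * x)))) _ 0)//.
- by rewrite mulr0 oppr0 expR0 mulr1 -EFinB sub0r opprK.
- by apply: continuous_subspaceT; exact: continuous_expRNM.
- rewrite [X in _ --> X](_ : 0 = - (a^-1 * 0)); last by rewrite mulr0 oppr0.
  apply: cvgN; apply: cvgMl_tmp.
  apply: (cvg_comp (fun x => a * x) (fun x => expR (- x)));
    last exact: cvgr_expR.
  exact: gt0_cvgMry.
- apply: cvg_at_right_filter.
  by apply: cvgN; apply: cvgMl_tmp; exact: continuous_expRNM.
- by move=> x _; rewrite derive1E; exact: derive_val.
Qed.

Lemma cosh_integral_scale {R : realType} (q c : R) : 0 < c ->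
  cosh_integral q =
  (c%:E * \int[@lebesgue_measure R]_(x in `[0%R, +oo[)
    (cosh_ratio q (c * x))%:E)%E.
Proof.
move=> c0; rewrite /cosh_integral.
have dc (x : R) : is_derive x 1 (fun x => c * x) c.
  apply: is_derive_eq.
  by rewrite /GRing.scale/= !(addr0, add0r, mulr0, mul0r, mulr1).
have D : (fun x : R => c * x)^`()%classic = cst c.
  apply/funext => x; rewrite derive1E; exact: derive_val.
have := @increasing_ge0_integration_by_substitutiony R (fun x => c * x)
  (cosh_ratio q) 0.
rewrite mulr0 => ->.
- rewrite -ge0_integralZl_EFin//=; first last.
  + exact: ltW.
  + apply/measurable_EFinP.
    apply: (measurableT_comp (measurable_cosh_ratio q setT)).
    exact: measurable_funM.
  + by move=> x _; rewrite lee_fin cosh_ratio_ge0.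
  + by apply: eq_integral => x _; rewrite fctE D mulrC EFinM.
- by move=> x y _ _; rewrite ltr_pM2l.
- by rewrite D => x _; exact: cst_continuous.
- by rewrite D; exact: is_cvg_cst.
- by rewrite D; exact: is_cvg_cst.
- split => [//|]; apply: cvg_at_right_filter; exact: mulrl_continuous.
- exact: gt0_cvgMry.
- by apply: continuous_subspaceT; exact: continuous_cosh_ratio.
- by move=> x _; exact: cosh_ratio_ge0.
Qed.

(** The substitution [x = 3 y] in all integrals but the first turns this into
    the pointwise identity
    [cosh (q y) / cosh y + cosh (q y) / cosh (3 y)
     = 2 cosh (q y) cosh (2 y) / cosh (3 y)], which is the triple-angle formula
    [cosh (3 y) = cosh y * (2 cosh (2 y) - 1)]. The equation is written with
    additions only because the integrals are not yet known to be finite. *)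
Lemma cosh_integral_triple {R : realType} (q : R) :
  (3%:E * cosh_integral q + cosh_integral (q / 3) =
   cosh_integral ((q - 2) / 3) + cosh_integral ((q + 2) / 3))%E.
Proof.
rewrite (cosh_integral_scale (q / 3) 3)//.
rewrite (cosh_integral_scale ((q - 2) / 3) 3)//.
rewrite (cosh_integral_scale ((q + 2) / 3) 3)//.
have K0 (r c x : R) : (0 <= (cosh_ratio r (c * x))%:E)%E.
  by rewrite lee_fin cosh_ratio_ge0.
have mK (r c : R) (D : set R) :
    measurable_fun D (fun x => (cosh_ratio r (c * x))%:E).
  apply/measurable_EFinP.
  apply: (measurableT_comp (measurable_cosh_ratio r setT)).
  exact: measurable_funM.
have KD (r c r' c' : R) :
    (\int[@lebesgue_measure R]_(x in `[0%R, +oo[) (cosh_ratio r (c * x))%:E +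
     \int[@lebesgue_measure R]_(x in `[0%R, +oo[) (cosh_ratio r' (c' * x))%:E =
     \int[@lebesgue_measure R]_(x in `[0%R, +oo[)
       (cosh_ratio r (c * x) + cosh_ratio r' (c' * x))%:E)%E.
  rewrite -ge0_integralD//; [exact: mK|exact: mK].
have -> : cosh_integral q = (\int[@lebesgue_measure R]_(x in `[0%R, +oo[)
    (cosh_ratio q (1 * x))%:E)%E.
  by apply: eq_integral => x _; rewrite mul1r.
rewrite -!ge0_muleDr; try by apply: integral_ge0 => x _.
rewrite !KD; congr (_ * _)%E; apply: eq_integral => x _; congr EFin.
rewrite mul1r /cosh_ratio.
have E1 : q / 3 * (3 * x) = q * x by field.
have E2 : (q - 2) / 3 * (3 * x) = q * x - 2 * x by field.
have E3 : (q + 2) / 3 * (3 * x) = q * x + 2 * x by field.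
rewrite E1 E2 E3 !opprD opprK !expRD !expRN !expRM_natl.
have E0 : expR x != 0 by rewrite gt_eqF// expR_gt0.
have S0 : expR x + (expR x)^-1 != 0.
  by rewrite gt_eqF// addr_gt0// ?invr_gt0 expR_gt0.
have T0 : expR x ^+ 3 + expR x ^- 3 != 0.
  by rewrite gt_eqF// addr_gt0// ?invr_gt0 exprn_gt0// expR_gt0.
have T1 : expR x ^+ 3 + expR x ^- 3 =
    (expR x + (expR x)^-1) * (expR x ^+ 2 + expR x ^- 2 - 1) by field.
move: T0; rewrite {}T1 mulf_eq0 negb_or => /andP[_].
move: (expR x + (expR x)^-1) (expR x ^+ 2) (expR x ^- 2) S0 => S W W' S0 T0.
move: (expR (q * x)) ((expR (q * x))^-1) => a a'.
by field; rewrite S0 T0.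
Qed.

Lemma cosh_ratio_ge {R : realType} (q x : R) : q <= 1 -> 0 <= x ->
  expR (- ((1 - q) * x)) <= cosh_ratio q x.
Proof.
move=> q1 x0; rewrite ler_pdivlMr ?addr_gt0 ?expR_gt0// mulrDr -!expRD.
rewrite (_ : - ((1 - q) * x) + x = q * x); last by ring.
by rewrite lerD2l ler_expR; nra.
Qed.

(** The first exponential on the right carries the singularity of the integral
    at [q = 1]; the exponential on the left compensates the second one there, so
    that their difference integrates to [2 (1 - q) / ((1 + q) (3 - q))]. *)
Lemma cosh_ratio_le {R : realType} (q x : R) : q <= 1 -> 0 <= x ->
  cosh_ratio q x + expR (- ((3 - q) * x)) <=
  expR (- ((1 - q) * x)) + expR (- ((1 + q) * x)).
Proof.
move=> q1 x0; rewrite -lerBrDr ler_pdivrMr ?addr_gt0 ?expR_gt0//.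
have distr (A B C E F : R) : (A + B - C) * (E + F) =
  A * E + A * F + (B * E + B * F) - (C * E + C * F) by ring.
rewrite distr -!expRD.
rewrite (_ : - ((1 - q) * x) + x = q * x); last by ring.
rewrite (_ : - ((1 + q) * x) + x = - (q * x)); last by ring.
rewrite (_ : - ((3 - q) * x) + x = - ((1 - q) * x) - x); last by ring.
have : expR (- ((3 - q) * x) - x) <= expR (- ((1 + q) * x) - x).
  by rewrite ler_expR; nra.
lra.
Qed.

Lemma cosh_integral_bounds {R : realType} (q : R) : 0 <= q < 1 ->
  ((1 - q)^-1%:E <= cosh_integral q <=
   ((1 - q)^-1 + (1 - q))%:E)%E.
Proof.
move=> /andP[q0 q1].
have mE (a : R) (D : set R) : measurable_fun D (fun x => (expR (- (a * x)))%:E).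
  apply/measurable_EFinP; apply: measurable_funTS.
  apply: continuous_measurable_fun.
  exact: continuous_expRNM.
have mK (D : set R) : measurable_fun D (fun x => (cosh_ratio q x)%:E).
  by apply/measurable_EFinP; exact: measurable_cosh_ratio.
have iE (a : R) : 0 < a -> (\int[@lebesgue_measure R]_(x in `[0%R, +oo[)
    (expR (- (a * x)))%:E = (a^-1)%:E)%E by exact: integral_expRN.
apply/andP; split.
  rewrite -iE ?subr_gt0//; apply: ge0_le_integral => //.
  - exact: mE.
  - exact: mK.
  - move=> x /=; rewrite in_itv/= andbT => x0.
    by rewrite lee_fin cosh_ratio_ge// ltW.
have : (cosh_integral q + (3 - q)^-1%:E <= (1 - q)^-1%:E + (1 + q)^-1%:E)%E.
  have a1 : 0 < 1 - q by lra.
  have a2 : 0 < 1 + q by lra.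
  have a3 : 0 < 3 - q by lra.
  rewrite -(iE _ a1) -(iE _ a2) -(iE _ a3).
  rewrite -ge0_integralD//; [|by move=> x _; rewrite lee_fin cosh_ratio_ge0|
    exact: mK|exact: mE].
  rewrite -ge0_integralD//; [|exact: mE|exact: mE].
  apply: ge0_le_integral => //.
  - by move=> x _; rewrite lee_fin addr_ge0 ?expR_ge0 ?cosh_ratio_ge0.
  - by apply: emeasurable_funD; [exact: mK|exact: mE].
  - by apply: emeasurable_funD; exact: mE.
  - move=> x /=; rewrite in_itv/= andbT => x0.
    by rewrite -!EFinD lee_fin cosh_ratio_le// ltW.
case: (cosh_integral q) => [c| |].
- rewrite -!EFinD !lee_fin.
  suff : (1 + q)^-1 - (3 - q)^-1 <= 1 - q by lra.
  rewrite (_ : _ - _ = 2 * (1 - q) / ((1 + q) * (3 - q))); last first.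
    by field; apply/andP; split; lra.
  have d0 : 0 < (1 + q) * (3 - q) by apply: mulr_gt0; lra.
  by rewrite ler_pdivrMr// [leLHS]mulrC ler_pM2l ?subr_gt0//; nra.
- by rewrite addye// -EFinD leye_eq.
- by move=> _; exact: leNye.
Qed.

(** * The secant *)

Lemma sin_between {R : realType} (y : R) : 0 < y <= pi / 2 ->
  y * cos y <= sin y <= y.
Proof.
move=> /andP[y0 ypi].
have [c /[!in_itv]/= /andP[c0 cy]] : exists2 c, c \in `]0, y[%R &
    sin y - sin 0 = cos c * (y - 0).
  apply: (@MVT R sin cos) => //.
  by apply: continuous_subspaceT; exact: continuous_sin.
rewrite sin0 !subr0 => ->.
rewrite mulrC; apply/andP; split.
  rewrite ler_pM2r// ltW// ltr_cos//; rewrite in_itv/=; have := pi_gt0 R; lra.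
by rewrite ger_pMl// cos_le1.
Qed.

Lemma cos_triple {R : realType} (t : R) :
  cos (t *+ 3) = cos t * (4 * cos t ^+ 2 - 3).
Proof.
have st := sin2cos2 t.
by rewrite mulrS cosD cos_mulr2n sin_mulr2n; ring: st.
Qed.

Lemma cos_pi3 {R : realType} : cos (pi / 3 : R) = 2^-1.
Proof.
have c0 : 0 < cos (pi / 3 : R).
  by apply: cos_gt0_pihalf; have := pi_gt0 R; lra.
have : cos (pi / 3 *+ 3 : R) = - 1.
  by rewrite -cospi -mulr_natr; congr cos; field.
rewrite cos_triple; move: (cos _) c0 => c c0 c3.
(* The polynomial [4 c^3 - 3 c + 1] factors as [(c + 1) (2 c - 1)^2]. *)
have : (c + 1) * (2 * c - 1) ^+ 2 = 0.
  by transitivity (c * (4 * c ^+ 2 - 3) + 1); [ring|rewrite c3; ring].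
move/eqP; rewrite mulf_eq0 sqrf_eq0 => /orP[/eqP|/eqP]; lra.
Qed.

(** This is [(pi / 2) * sec (pi q / 2)]. *)
Definition sec_value {R : realType} (q : R) : R := pi / (2 * cos (pi / 2 * q)).

Lemma sec_valueN {R : realType} (q : R) : sec_value (- q) = sec_value q.
Proof. by rewrite /sec_value mulrN cosN. Qed.

(** With [t = pi q / 6] the three small angles are [t] and [t -+ pi / 3], and
    [cos (t + pi / 3) * cos (t - pi / 3) = (4 (cos t)^2 - 3) / 4
     = cos (3 t) / (4 cos t)]. *)
Lemma sec_value_triple {R : realType} (q : R) : -1 < q < 1 ->
  3 * sec_value q + sec_value (q / 3) =
  sec_value ((q - 2) / 3) + sec_value ((q + 2) / 3).
Proof.
move=> q1.
have piC : 0 < pi :> R by exact: pi_gt0.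
rewrite /sec_value.
pose t : R := pi / 2 * (q / 3).
have -> : pi / 2 * (q / 3) = t by [].
have -> : pi / 2 * q = t *+ 3 by rewrite /t -mulr_natr; field.
have -> : pi / 2 * ((q - 2) / 3) = t - pi / 3 by rewrite /t; field.
have -> : pi / 2 * ((q + 2) / 3) = t + pi / 3 by rewrite /t; field.
have c0 : cos t != 0.
  by rewrite gt_eqF// cos_gt0_pihalf//; rewrite /t; nra.
have s3 := sin2cos2 (pi / 3 : R); have st := sin2cos2 t.
have c30 : cos (t *+ 3) != 0.
  rewrite gt_eqF// cos_gt0_pihalf// (_ : t *+ 3 = pi / 2 * q).
    by nra.
  by rewrite /t -mulr_natr; field.
rewrite cosB cosD cos_pi3.
rewrite cos_triple in c30 *.
move: c30; rewrite mulf_eq0 negb_or c0 /= => D0.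
have PN : (cos t / 2 + sin t * sin (pi / 3)) *
    (cos t / 2 - sin t * sin (pi / 3)) =
    (4 * cos t ^+ 2 - 3) / 4.
  transitivity (cos t ^+ 2 / 4 - sin t ^+ 2 * sin (pi / 3) ^+ 2).
    by field.
  by rewrite s3 st cos_pi3; field.
have : (cos t / 2 + sin t * sin (pi / 3)) *
    (cos t / 2 - sin t * sin (pi / 3)) != 0.
  by rewrite PN mulf_neq0.
rewrite mulf_eq0 negb_or => /andP[P0 N0].
transitivity (2 * pi * cos t / (4 * cos t ^+ 2 - 3)).
  by field; apply/andP.
transitivity (pi / 2 * cos t /
  ((cos t / 2 + sin t * sin (pi / 3)) * (cos t / 2 - sin t * sin (pi / 3)))).
  by rewrite PN; field.
have key (P N : R) : P != 0 -> N != 0 ->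
    pi / (2 * P) + pi / (2 * N) = pi / 2 * (P + N) / (P * N).
  by move=> ? ?; field; apply/andP.
by rewrite key//; congr (_ * _ / _); field.
Qed.

(** The pole of [sec_value] at [q = 1] is [1 / (1 - q)]; with
    [y = pi (1 - q) / 2] the rest is [(pi / 2) * (1 / sin y - 1 / y)], and
    [y - sin y <= y (1 - cos y) <= y (sin y)^2 <= y^2 sin y]. *)
Lemma sec_value_bounds {R : realType} (q : R) : 0 <= q < 1 ->
  (1 - q)^-1 <= sec_value q <= (1 - q)^-1 + pi ^+ 2 / 4 * (1 - q).
Proof.
move=> /andP[q0 q1]; have piC : 0 < pi :> R by exact: pi_gt0.
pose y : R := pi / 2 * (1 - q).
have y0 : 0 < y <= pi / 2.
  rewrite /y mulr_gt0 ?subr_gt0 ?divr_gt0//=.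
  by rewrite ler_piMr ?gerBl// ltW// divr_gt0.
have /andP[y_gt0 y_le] := y0.
have /andP[ys sy] := sin_between _ y0.
have s0 : 0 < sin y by apply: sin_gt0_pi; lra.
have -> : sec_value q = pi / 2 / sin y.
  rewrite /sec_value (_ : pi / 2 * q = - (y - pi / 2)); last first.
    by rewrite /y; field.
  by rewrite cosN cosBpihalf; field; rewrite gt_eqF.
have -> : (1 - q)^-1 = pi / 2 / y by rewrite /y; field; lra.
have -> : pi ^+ 2 / 4 * (1 - q) = pi / 2 * y by rewrite /y; field.
apply/andP; split.
  by rewrite ler_pM2l ?divr_gt0// lef_pV2.
rewrite -mulrDr ler_pM2l ?divr_gt0//.
have c0 : 0 <= cos y by apply: cos_ge0_pihalf; lra.
have c1 : 1 - cos y <= sin y ^+ 2.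
  by rewrite sin2cos2; have := cos_le1 y; nra.
have y1 : y * (1 - cos y) <= y * (sin y * y).
  rewrite ler_pM2l//; apply: (le_trans c1); rewrite expr2.
  by rewrite ler_pM2l.
rewrite -(ler_pM2r s0) mulVf ?gt_eqF// -(ler_pM2r y_gt0) mul1r.
rewrite (_ : _ * y = sin y + y * (sin y * y)); first by lra.
by field; rewrite gt_eqF.
Qed.

(** * The maximum principle and the evaluation of the integral *)

(** The third hypothesis bounds [u q] by an average of three values, one of them
    at [(q + 2) / 3], which is three times closer to [1] than [q]. After [n]
    steps the average gives weight [3^-n] to a point so close to [1] that [u] is
    at most half of its supremum there. The number [n] is the same for all [q],
    so a positive supremum, attained or not, would exceed itself. *)
Lemma maximum_principle {R : realType} (u : R -> R) (K : R) :
  (forall q, -1 < q < 1 -> 0 <= u q) ->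
  (forall q, -1 < q < 1 -> u q <= K * (1 - `|q|)) ->
  (forall q, -1 < q < 1 ->
    3 * u q <= u ((q - 2) / 3) + u (q / 3) + u ((q + 2) / 3)) ->
  forall q, -1 < q < 1 -> u q = 0.
Proof.
move=> u0 uK u3.
pose S := [set u q | q in `]-1, 1[].
have S0 : S (u 0) by exists 0 => //=; rewrite in_itv/=; lra.
have K0 : 0 <= K.
  have h : -1 < (0 : R) < 1 by lra.
  by have := uK _ h; have := u0 _ h; rewrite normr0 subr0 mulr1; lra.
have S_ub : has_ubound S.
  exists K => _ [q /= /[!in_itv]/= q1 <-].
  by apply: (le_trans (uK _ q1)); rewrite ler_piMr// gerBl.
pose M := sup S.
have uM q : -1 < q < 1 -> u q <= M.
  by move=> q1; apply: ub_le_sup => //; exists q => //=; rewrite in_itv.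
have step n q : -1 < q < 1 -> u q <= M - (M - K * (1 - q) / 3 ^+ n) / 3 ^+ n.
  elim: n q => [|n IH] q q1.
    rewrite expr0 !divr1 subKr; apply: (le_trans (uK _ q1)).
    by rewrite ler_wpM2l// lerB// ler_norm.
  have q2 : -1 < (q + 2) / 3 < 1 by lra.
  have := u3 _ q1; have := IH _ q2.
  have : u ((q - 2) / 3) <= M by apply: uM; lra.
  have : u (q / 3) <= M by apply: uM; lra.
  have -> : M - (M - K * (1 - (q + 2) / 3) / 3 ^+ n) / 3 ^+ n =
    3 * (M - (M - K * (1 - q) / 3 ^+ n.+1) / 3 ^+ n.+1) - 2 * M.
    by rewrite exprS; field; rewrite expf_neq0.
  lra.
have M0 : M = 0.
  apply/eqP; rewrite eq_le; apply/andP; split; last first.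
    by apply: (le_trans (u0 0 _)); [lra|apply: uM; lra].
  rewrite leNgt; apply/negP => M0.
  have [n nK] : exists n : nat, 4 * K / M < 3 ^+ n.
    exists (Num.bound (4 * K / M)).
    have /archi_boundP/lt_trans : 0 <= 4 * K / M.
      by rewrite divr_ge0// ?mulr_ge0// ltW.
    by apply; rewrite -natrX ltr_nat ltn_expl.
  have : M <= M - M / 2 / 3 ^+ n.
    apply: ge_sup; first by exists (u 0).
    move=> _ [q /= /[!in_itv]/= q1 <-]; apply: (le_trans (step n _ q1)).
    have n0 : 0 < 3 ^+ n :> R by rewrite exprn_gt0.
    rewrite lerB// ler_pM2r ?invr_gt0//.
    suff : K * (1 - q) / 3 ^+ n <= M / 2 by lra.
    rewrite ler_pdivrMr//; move: nK; rewrite ltr_pdivrMr// => nK.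
    have : K * (1 - q) <= K * 2 by rewrite ler_wpM2l//; lra.
    lra.
  by rewrite lerBrDr gerDl leNgt divr_gt0// ?exprn_gt0// divr_gt0.
by move=> q q1; apply/eqP; rewrite eq_le u0// -M0 uM.
Qed.

(** Both sides are even, satisfy the same three-term equation and have the same
    pole at [q = 1] up to an error proportional to [1 - q], so the maximum
    principle applies to the absolute value of their difference. *)
Theorem cosh_integralE {R : realType} (q : R) : -1 < q < 1 ->
  cosh_integral q = (sec_value q)%:E.
Proof.
have bnd (r : R) : -1 < r < 1 ->
    ((1 - `|r|)^-1%:E <= cosh_integral r <=
     ((1 - `|r|)^-1 + (1 - `|r|))%:E)%E.
  move=> r1; have -> : cosh_integral r = cosh_integral `|r|.
    by have [_|_] := ger0P r; rewrite ?cosh_integralN.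
  by apply: cosh_integral_bounds; rewrite normr_ge0 ltr_norml.
pose c (r : R) := fine (cosh_integral r).
have cE r : -1 < r < 1 -> cosh_integral r = (c r)%:E.
  move=> /bnd /andP[lo hi]; rewrite /c fineK// fin_real//.
  by rewrite (lt_le_trans (ltNyr _) lo) (le_lt_trans hi (ltry _)).
pose u r := `|c r - sec_value r|.
have u0 : forall r, -1 < r < 1 -> u r = 0.
  apply: (maximum_principle u (1 + pi ^+ 2 / 4)) => // r r1.
  - exact: normr_ge0.
  - have r0 : 0 <= `|r| < 1 by rewrite normr_ge0 ltr_norml.
    have /andP[] := sec_value_bounds _ r0.
    have -> : sec_value `|r| = sec_value r.
      by have [_|_] := ger0P r; rewrite ?sec_valueN.
    have /andP[] := bnd _ r1; rewrite (cE _ r1) !lee_fin.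
    have : 0 <= pi ^+ 2 / 4 * (1 - `|r|).
      by rewrite mulr_ge0// ?subr_ge0 ?divr_ge0 ?sqr_ge0//; lra.
    by rewrite /u ler_norml; nra.
  - have := cosh_integral_triple r.
    have r1' : -1 < (r - 2) / 3 < 1 by lra.
    have r2' : -1 < r / 3 < 1 by lra.
    have r3' : -1 < (r + 2) / 3 < 1 by lra.
    rewrite (cE _ r1) (cE _ r1') (cE _ r2') (cE _ r3') -EFinM -!EFinD => -[].
    have := sec_value_triple _ r1 => sE ce.
    have -> : 3 * u r = `|3 * (c r - sec_value r)|.
      by rewrite normrM gtr0_norm.
    have -> : 3 * (c r - sec_value r) =
      (c ((r - 2) / 3) - sec_value ((r - 2) / 3)) -
      (c (r / 3) - sec_value (r / 3)) +
      (c ((r + 2) / 3) - sec_value ((r + 2) / 3)) by lra.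
    by apply: (le_trans (ler_normD _ _)); rewrite lerD2r ler_normB.
move=> q1; rewrite cE//; congr EFin; apply/eqP.
by rewrite -subr_eq0 -normr_eq0; apply/eqP; exact: u0.
Qed.

(** * The exponential change of variables *)

(** The derivative of [x |-> l * expR x] is unbounded at [+oo], so the
    substitution is made on the compact intervals [[-n, n]] and the two sides
    are the limits of these integrals by monotone convergence. *)
Lemma ge0_integral_expR_substitution {R : realType} (l : R) (G : R -> R) :
  0 < l -> {in `]0, +oo[, continuous G} -> (forall z, 0 < z -> 0 <= G z) ->
  (\int[@lebesgue_measure R]_(z in `]0%R, +oo[) (G z)%:E =
   \int[@lebesgue_measure R]_x (G (l * expR x) * (l * expR x))%:E)%E.
Proof.
move=> l0 cG G0.
pose F (x : R) := l * expR x.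
have F0 x : 0 < F x by rewrite mulr_gt0// expR_gt0.
have dF (x : R) : is_derive x 1 F (F x).
  exact: is_derive_eq.
have F'E : F^`()%classic = F.
  by apply/funext => x; rewrite derive1E; exact: derive_val.
have cF : continuous F.
  by move=> x; exact/differentiable_continuous/derivable1_diffP.
have incF : {homo F : x y / x < y}.
  by move=> x y xy; rewrite ltr_pM2l// ltr_expR.
have cGF : continuous (fun x => G (F x) * F x).
  move=> x; apply: cvgM; last exact: cF.
  by apply: continuous_comp; [exact: cF|apply: cG; rewrite in_itv/= F0].
pose I (n : nat) : set R := `[- n%:R, n%:R]%classic.
pose J (n : nat) : set R := `[F (- n%:R), F n%:R]%classic.
have substn n : (\int[@lebesgue_measure R]_(z in J n) (G z)%:E =
    \int[@lebesgue_measure R]_(x in I n) (G (F x) * F x)%:E)%E.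
  rewrite /J integration_by_substitution_increasing.
  - by apply: eq_integral => x _; rewrite fctE F'E.
  - by rewrite (@le_trans _ _ 0)// oppr_le0.
  - by move=> x y _ _; exact: incF.
  - by rewrite F'E => x _; exact: cF.
  - rewrite F'E; apply/cvg_ex; exists (F (- n%:R)).
    by apply: cvg_at_right_filter; exact: cF.
  - rewrite F'E; apply/cvg_ex; exists (F n%:R).
    by apply: cvg_at_left_filter; exact: cF.
  - split.
    + by move=> x _; exact: ex_derive.
    + by apply: cvg_at_right_filter; exact: cF.
    + by apply: cvg_at_left_filter; exact: cF.
  - apply: continuous_in_subspaceT => x; rewrite inE/= in_itv/= => /andP[xF _].
    by apply: cG; rewrite in_itv/= andbT (lt_le_trans (F0 _) xF).
have IT : \bigcup_n I n = setT.
  apply/seteqP; split => // x _; exists (Num.bound `|x|) => //=.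
  by rewrite /I/= in_itv/= -ler_norml ltW// archi_boundP.
have JT : \bigcup_n J n = `]0, +oo[%classic.
  apply/seteqP; split => z /=; rewrite in_itv/= ?andbT.
    by move=> [n _]; rewrite /J/= in_itv/= => /andP[+ _]; apply: lt_le_trans.
  move=> z0; have zl0 : 0 < z / l by rewrite divr_gt0.
  have [n _ /= In] : (\bigcup_n I n) (ln (z / l)) by rewrite IT.
  exists n => //=; have -> : z = F (ln (z / l)).
    by rewrite /F lnK ?posrE// mulrC divfK// gt_eqF.
  by move: In; rewrite /I /J/= !in_itv/= !ler_pM2l// !ler_expR.
have ndI : nondecreasing_seq I.
  move=> m n mn; apply/subsetPset => x.
  rewrite /I /J/= !in_itv/= => /andP[mx xm].
  by have := ler_nat R m n; rewrite mn => /idP mnR; apply/andP; split; lra.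
have ndJ : nondecreasing_seq J.
  move=> m n mn; apply/subsetPset => x.
  rewrite /I /J/= !in_itv/= => /andP[mx xm].
  have mnR : m%:R <= n%:R :> R by rewrite ler_nat.
  apply/andP; split.
    by rewrite (le_trans _ mx)// ler_pM2l// ler_expR lerN2.
  by rewrite (le_trans xm)// ler_pM2l// ler_expR.
have lim1 : (\int[@lebesgue_measure R]_(z in J n) (G z)%:E @[n --> \oo] -->
    \int[@lebesgue_measure R]_(z in `]0%R, +oo[) (G z)%:E)%E.
  rewrite -JT; apply: ge0_nondecreasing_set_cvg_integral => //.
  - by move=> n; exact: measurable_itv.
  - move=> n; apply/measurable_EFinP.
    have JS : J n `<=` `]0, +oo[ by rewrite -JT; exact: bigcup_sup.
    apply: (measurable_funS _ JS) => //.
    apply: open_continuous_measurable_fun => //.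
    by move=> x; rewrite inE/= => ?; exact: cG.
  - move=> n z Jz; rewrite lee_fin G0//.
    have : (\bigcup_n J n) z by exists n.
    by rewrite JT /= in_itv/= andbT.
have lim2 : (\int[@lebesgue_measure R]_(x in I n) (G (F x) * F x)%:E
      @[n --> \oo] -->
    \int[@lebesgue_measure R]_x (G (F x) * F x)%:E)%E.
  rewrite -[X in integral _ X]IT.
  apply: ge0_nondecreasing_set_cvg_integral => //.
  - by move=> n; exact: measurable_itv.
  - move=> n; apply/measurable_EFinP; apply: measurable_funTS.
    exact: continuous_measurable_fun.
  - by move=> n x _; rewrite lee_fin mulr_ge0// ?G0// ltW.
move: lim1; under eq_fun do rewrite substn.
by move=> lim1; exact: (cvg_unique _ lim1 lim2).
Qed.

Lemma ge0_integral_fold {R : realType} (f : R -> R) :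
  continuous f -> (forall x, 0 <= f x) ->
  (\int[@lebesgue_measure R]_x (f x)%:E =
   \int[@lebesgue_measure R]_(x in `[0%R, +oo[) (f x + f (- x))%:E)%E.
Proof.
move=> cf f0.
have cfN : continuous (f \o -%R).
  by move=> x; apply: continuous_comp; [exact: oppr_continuous|exact: cf].
have mf D : measurable_fun D (EFin \o f).
  apply/measurable_EFinP; apply: measurable_funTS.
  exact: continuous_measurable_fun.
have mfN D : measurable_fun D (EFin \o (f \o -%R)).
  apply/measurable_EFinP; apply: measurable_funTS.
  exact: continuous_measurable_fun.
under [RHS]eq_integral do rewrite EFinD.
rewrite ge0_integralD//; try by move=> x _; rewrite lee_fin.
  - have -> : (\int[@lebesgue_measure R]_(x in `[0%R, +oo[) (f (- x))%:E =
        \int[@lebesgue_measure R]_(x in `]-oo, 0%R]) (f x)%:E)%E.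
      rewrite -[X in `]-oo, X]]oppr0 ge0_integration_by_substitutionNy//.
      exact: continuous_subspaceT.
    rewrite -integral_itv_obnd_cbnd// addeC -ge0_integral_setU//=; last 3 first.
    + exact: mf.
    + by move=> x _; rewrite lee_fin.
    + rewrite disj_set2E; apply/eqP; rewrite -subset0 => x/=.
      by rewrite !in_itv/= andbT ltNge => -[? /negP].
    + by rewrite -setCitvr setvU.
  - exact: mf.
  - exact: mfN.
Qed.

(** * The energy formula *)

Lemma continuous_resolvent_term {R : realType} (p l : R) :
  {in `]0, +oo[, continuous
    (fun z : R => z `^ (p - 1) * (l ^+ 2 / (l ^+ 2 + z ^+ 2)))}.
Proof.
move=> z; rewrite in_itv/= andbT => z0.
have c0 : l ^+ 2 + z ^+ 2 != 0.
  by rewrite gt_eqF// ltr_wpDl// ?sqr_ge0// exprn_gt0.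
have cp : {for z, continuous (fun x : R => x `^ (p - 1))}.
  apply: differentiable_continuous; apply/derivable1_diffP.
  by apply: derivable_powR; rewrite in_itv/= andbT.
apply: cvgM; first exact: cp.
apply: cvgMl_tmp; apply: cvgV => //.
by apply: cvgD; [exact: cvg_cst|exact: exprn_continuous].
Qed.

Lemma measurable_resolvent_term {R : realType} (p l : R) :
  measurable_fun (`]0, +oo[%classic : set R)
    (fun z : R => z `^ (p - 1) * (l ^+ 2 / (l ^+ 2 + z ^+ 2))).
Proof.
apply: open_continuous_measurable_fun => // z.
by rewrite inE/=; exact: continuous_resolvent_term.
Qed.

Lemma resolvent_term_ge0 {R : realType} (p l z : R) :
  0 <= z `^ (p - 1) * (l ^+ 2 / (l ^+ 2 + z ^+ 2)).
Proof. by rewrite mulr_ge0 ?powR_ge0// divr_ge0// ?addr_ge0// sqr_ge0. Qed.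

(** The substitution [z = l * expR x] turns the integrand into
    [l^p * exp ((p - 1) x) / (exp x + exp (- x))] on the whole line, and folding
    the line at [0] makes it [l^p] times [cosh_ratio (p - 1)]. *)
Lemma integral_resolvent_term_gt0 {R : realType} (p l : R) :
  0 < p < 2 -> 0 < l ->
  (\int[@lebesgue_measure R]_(z in `]0%R, +oo[)
     (z `^ (p - 1) * (l ^+ 2 / (l ^+ 2 + z ^+ 2)))%:E =
   (l `^ p * (pi / (2 * sin (p * pi / 2))))%:E)%E.
Proof.
move=> p02 l0; have /andP[p0 p2] := p02.
rewrite (ge0_integral_expR_substitution _ _ l0); last 2 first.
- exact: continuous_resolvent_term.
- by move=> z _; exact: resolvent_term_ge0.
have -> : pi / (2 * sin (p * pi / 2)) = sec_value (p - 1).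
  rewrite /sec_value -(cosBpihalf (p * pi / 2)).
  by congr (_ / (_ * cos _)); field.
have p1 : -1 < p - 1 < 1 by lra.
rewrite EFinM -(cosh_integralE _ p1) /cosh_integral.
rewrite -ge0_integralZl_EFin//; last 3 first.
- by move=> x _; rewrite lee_fin cosh_ratio_ge0.
- by apply/measurable_EFinP; exact: measurable_cosh_ratio.
- exact: powR_ge0.
pose k (x : R) := l `^ p * (expR ((p - 1) * x) / (expR x + expR (- x))).
have kE x : (l * expR x) `^ (p - 1) *
    (l ^+ 2 / (l ^+ 2 + (l * expR x) ^+ 2)) * (l * expR x) = k x.
  rewrite powRM ?expR_ge0 ?(ltW l0)//.
  have -> : expR x `^ (p - 1) = expR ((p - 1) * x).
    by rewrite /powR gt_eqF ?expR_gt0// expRK.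
  rewrite /k expRN -(@mulr_powRB1 _ l p) ?(ltW l0)//.
  have E0 : expR x != 0 by rewrite gt_eqF// expR_gt0.
  have ln0 : l != 0 by rewrite gt_eqF.
  have E2 : 1 + expR x ^+ 2 != 0 by rewrite gt_eqF// ltr_pwDl// sqr_ge0.
  move: (l `^ (p - 1)) (expR ((p - 1) * x)) (expR x) E0 E2 => a b e E0 E2.
  have E1 : e ^+ 2 + 1 != 0 by rewrite addrC.
  have E3 : l ^+ 2 + (l * e) ^+ 2 != 0.
    by rewrite gt_eqF// ltr_pwDl ?sqr_ge0// exprn_gt0.
  by field; rewrite E0 -expr2 E1.
transitivity (\int[@lebesgue_measure R]_x (k x)%:E)%E.
  by apply: eq_integral => x _; congr EFin; exact: kE.
rewrite ge0_integral_fold; last 2 first.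
- move=> x; apply: cvgMl_tmp; apply: cvgM; first exact: continuous_expRM.
  exact: continuous_inv_2cosh.
- by move=> x; rewrite /k mulr_ge0 ?powR_ge0// divr_ge0 ?addr_ge0 ?expR_ge0.
apply: eq_integral => x _; rewrite -EFinM /k /cosh_ratio -mulrDr mulrN opprK.
by rewrite [expR (- x) + _]addrC -mulrDl.
Qed.

Lemma integral_resolvent_term {R : realType} (p l : R) : 0 < p < 2 ->
  (\int[@lebesgue_measure R]_(z in `]0%R, +oo[)
     (z `^ (p - 1) * (l ^+ 2 / (l ^+ 2 + z ^+ 2)))%:E =
   (`|l| `^ p * (pi / (2 * sin (p * pi / 2))))%:E)%E.
Proof.
move=> p02; have [->|l0] := eqVneq l 0.
  rewrite normr0 powR0 ?mul0r; last by case/andP: p02 => /gt_eqF ->.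
  by apply: integral0_eq => z _; rewrite expr0n/= mul0r mulr0.
rewrite -(real_normK (num_real l)).
by apply: integral_resolvent_term_gt0 => //; rewrite normr_gt0.
Qed.

Theorem theorem1 (R : realType) (V : finType) (G : sgraph V) (p : R)
    (hG : bipartite G) (p_gt0 : 0 < p) (p_lt2 : p < 2) :
  cintegrable (@lebesgue_measure R) `]0, +oo[ (energy_integrand p G) /\
  (schatten_energy p G)%:C =
    (2 * sin (p * pi / 2) / pi)%:C *
    cintegral (@lebesgue_measure R) `]0, +oo[ (energy_integrand p G).
Proof.
set s := eigenvalues (adjacency R[i] G).
pose f (z : R) := \sum_(l <- s)
  z `^ (p - 1) * (complex.Re l ^+ 2 / (complex.Re l ^+ 2 + z ^+ 2)).
have p02 : 0 < p < 2 by rewrite p_gt0.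
have f0 z : 0 <= f z by apply: sumr_ge0 => l _; exact: resolvent_term_ge0.
have mf : measurable_fun (`]0, +oo[%classic : set R) f.
  by apply: measurable_sum => l; exact: measurable_resolvent_term.
have sin0 : 0 < sin (p * pi / 2).
  by apply: sin_gt0_pi; have := pi_gt0 R; nra.
have If : (\int[@lebesgue_measure R]_(z in `]0%R, +oo[) (f z)%:E =
    (schatten_energy p G * (pi / (2 * sin (p * pi / 2))))%:E)%E.
  under eq_integral do rewrite -sumEFin.
  rewrite ge0_integral_sum//; last 2 first.
  - by move=> l; apply/measurable_EFinP; exact: measurable_resolvent_term.
  - by move=> l z _; rewrite lee_fin resolvent_term_ge0.
  rewrite /schatten_energy mulr_suml -sumEFin; apply: eq_big_seq => l ls.
  rewrite integral_resolvent_term//.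
  rewrite [in RHS](@eigenvalues_adjacency_real R V G l ls).
  by rewrite /Normc.normc/= expr0n addr0 sqrtr_sqr.
have fE z : z \in `]0%R, +oo[%classic -> energy_integrand p G z = (f z)%:C.
  by rewrite inE/= in_itv/= andbT => z0; exact: energy_integrandE.
split.
  split.
    apply: (@eq_integrable _ _ _ (@lebesgue_measure R) `]0, +oo[%classic _
      (fun x => (f x)%:E)) => //.
      by move=> z /fE ->.
    apply/integrableP; split; first exact/measurable_EFinP.
    under eq_integral do rewrite /= ger0_norm//.
    by rewrite If ltry.
  apply: (@eq_integrable _ _ _ (@lebesgue_measure R) `]0, +oo[%classic _
    (fun=> 0%E)) => //.
    by move=> z /fE ->.
  exact: integrable0.
rewrite /cintegral.
have -> : \int[@lebesgue_measure R]_(z in `]0, +oo[)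
      complex.Re (energy_integrand p G z) =
    schatten_energy p G * (pi / (2 * sin (p * pi / 2))).
  rewrite /Rintegral; under eq_integral => z /fE -> do [].
  by rewrite If.
have -> : \int[@lebesgue_measure R]_(z in `]0, +oo[)
    complex.Im (energy_integrand p G z) = 0.
  rewrite /Rintegral; under eq_integral => z /fE -> do [].
  by rewrite integral0.
rewrite complexr0 -rmorphM; apply: (congr1 (real_complex R)).
have sN : sin (p * pi / 2) != 0 by rewrite gt_eqF.
have pN : (pi : R) != 0 by rewrite gt_eqF// pi_gt0.
move: (schatten_energy _ _) (sin _) sN => e a aN.
by move: (pi : R) pN => b bN; field; apply/andP.
Qed.
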